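(* Let $\delta\geq 2$ be an integer. If $\delta$ is sufficiently small, namely $\delta = O\left(\frac{\log n}{\log\log n}\right)$, then, in the on-line majority edge-colouring game, there is no strategy for the Algorithm using at most four colours against every strategy of the Presenter for $n$-vertex graphs with minimum degree $\delta$.
   Context: All graphs are finite and simple; $\log$ is the natural logarithm, and the $O$-notation is with respect to $n\to\infty$. A majority edge-colouring of a graph $G$ is a (not necessarily proper) colouring of the edges of $G$ such that, for every vertex $v$ of $G$, at most half of the edges incident with $v$ receive the same colour. On-line majority edge-colouring game for $n$-vertex graphs with minimum degree $\delta$: the integers $n$ and $\delta$ are fixed and known before the game. Two players, the Presenter and the Algorithm, start with an edgeless graph. In each round the Presenter reveals one new edge, and the Algorithm must immediately and irrevocably assign a colour to this edge, based only on the part of the graph revealed so far and its colouring. The Presenter may choose each edge depending on the entire history of the game, including all colours assigned by the Algorithm. The graph formed by all revealed edges when the game ends is the final graph; it must have $n$ vertices and minimum degree $\delta$. Vertices of smaller degree may appear during the game. The Algorithm's goal is that the resulting colouring of the final graph is a majority edge-colouring. *)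

(* Defs.v *)
From mathcomp Require Import all_boot.

Set Implicit Arguments.
Unset Strict Implicit.
Unset Printing Implicit Defensive.

(* A finite simple graph on the vertex type V is given by its
   edge set E : {set {set V}}, whose members are 2-element sets. *)
Section Graphs.
Variable V : finType.

Definition incident (E : {set {set V}}) (v : V) : {set {set V}} :=
  [set e in E | v \in e].

Definition degree (E : {set {set V}}) (v : V) : nat := #|incident E v|.

Definition has_min_degree (E : {set {set V}}) (d : nat) : Prop :=
  (forall v, d <= degree E v) /\ (exists v, degree E v = d).

(* Only the values of f on members of E matter. *)
Definition majority_edge_colouring (K : eqType) (E : {set {set V}})
    (f : {set V} -> K) : Prop :=
  forall (v : V) (c : K),
    2 * #|[set e in incident E v | f e == c]| <= degree E v.

End Graphs.

Section Game.
Variables (V : finType) (K : eqType).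

(* The revealed edges with their colours, oldest first. *)
Definition history : Type := seq ({set V} * K).

Definition revealed (h : history) : {set {set V}} :=
  [set e in [seq ec.1 | ec <- h]].

(* The colour given to e, or None if e has not been revealed. *)
Definition colour_of (h : history) (e : {set V}) : option K :=
  ohead [seq ec.2 | ec <- h & ec.1 == e].

(* The colour given to the edge just revealed after a given history. *)
Definition algorithm : Type := history -> {set V} -> K.

(* The next edge revealed, or None to end the game. *)
Definition presenter : Type := history -> option {set V}.

(* The histories that occur when A plays against P. *)
Inductive occurs (A : algorithm) (P : presenter) : history -> Prop :=
| occurs_start : occurs A P [::]
| occurs_round h e : occurs A P h -> P h = Some e ->
    occurs A P (rcons h (e, A h e)).

(* P follows the rules, whatever the Algorithm does: every edge joins two
   distinct vertices and is new, and the final graph has minimum degree d.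
   As edges are never repeated, every play ends. *)
Definition legal_presenter (d : nat) (P : presenter) : Prop :=
  forall (A : algorithm) (h : history), occurs A P h ->
    match P h with
    | Some e => #|e| = 2 /\ e \notin revealed h
    | None => has_min_degree (revealed h) d
    end.

Definition wins_against (A : algorithm) (P : presenter) : Prop :=
  forall h : history, occurs A P h -> P h = None ->
    majority_edge_colouring (revealed h) (colour_of h).

Definition winning_algorithm (d : nat) (A : algorithm) : Prop :=
  forall P : presenter, legal_presenter d P -> wins_against A P.

End Game.

(* Main.v *)
Require Import Defs.
From mathcomp Require Import all_boot all_order all_algebra.
From mathcomp Require Import all_classical all_reals all_analysis.
From mathcomp Require Import zify lra seq fintype finset.
Import Order.TTheory GRing.Theory Num.Theory.
Import numFieldNormedType.Exports.

(** The Algorithm is deterministic, so a Presenter who knows it can foresee all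
    its answers; it is enough to find, for each algorithm, one fixed list of
    edges on which it loses.

    As long as some vertex [w] is isolated, the Presenter can end the game
    without touching a given vertex [v] of degree at least [d]: join all other
    vertices to each other, and give [w] exactly [d] edges.  A winning algorithm
    must therefore satisfy the majority condition at [v] already at that moment
    ([majority_before_end]).

    Split the four colours into two pairs [S] and its complement.  A vertex of
    odd degree [D >= d] whose edges all have colours in one pair violates the
    majority condition, one of the two colours having more than half of its
    edges ([odd_pure_not_majority]).  Such a vertex can be forced
    ([force_pure]): join a vertex with [i] edges, all coloured in [S], to a
    vertex with [j] edges, all coloured in the complement.  Whatever the colour
    of the new edge, the first vertex then has [i + 1] edges in [S], or the
    second one has [j + 1] edges in the complement.  Building each of the two
    vertices recursively from its own supply of isolated vertices takes a number
    of vertices that obeys Pascal's rule, hence ['C(D + D, D) <= 4 ^ D] vertices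
    in all.  So the Algorithm loses as soon as [4 ^ (d + 2) <= n]
    ([no_winning_algorithm]).  A bound [d = O(ln n / ln (ln n))] makes
    [d = o(ln n)], so this holds for all large [n]. *)

Set Implicit Arguments.
Unset Strict Implicit.
Unset Printing Implicit Defensive.

Lemma subset_of_card (T : finType) (B : {set T}) m :
  m <= #|B| -> exists2 C : {set T}, C \subset B & #|C| = m.
Proof.
case/card_geqP => s [uniq_s size_s s_sub]; exists [set:: s].
  by apply/subsetP => x; rewrite inE => /s_sub.
by rewrite -size_s -(card_uniqP uniq_s); apply: eq_card => x; rewrite inE.
Qed.

(** * Plays against a fixed algorithm *)

Section Plays.
Variables (V : finType) (K : eqType).
Implicit Types (A : algorithm V K) (h t : seq ({set V} * K)) (v w : V) (c : K).
Implicit Types (e : {set V}) (F : {set V}).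

Definition edges h : seq {set V} := map fst h.

Definition colours_at h v : seq K :=
  [seq ec.2 | ec : {set V} * K <- h & v \in ec.1].

(** The histories that can arise when [A] answers a Presenter who is bound only
    by the rule that each edge is new and has two ends. *)
Inductive play A : history V K -> Prop :=
| play_start : play A [::]
| play_round h e : play A h -> #|e| = 2 -> e \notin edges h ->
    play A (rcons h (e, A h e)).

Lemma mem_revealed h e : (e \in revealed h) = (e \in edges h).
Proof. by rewrite inE. Qed.

Lemma edges_cat h t : edges (h ++ t) = edges h ++ edges t.
Proof. exact: map_cat. Qed.

Lemma edges_rcons h e c : edges (rcons h (e, c)) = rcons (edges h) e.
Proof. exact: map_rcons. Qed.

Lemma colours_at_cat h t v :
  colours_at (h ++ t) v = colours_at h v ++ colours_at t v.
Proof. by rewrite /colours_at filter_cat map_cat. Qed.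

Lemma colours_at_rcons h e c v :
  colours_at (rcons h (e, c)) v =
  if v \in e then rcons (colours_at h v) c else colours_at h v.
Proof. by rewrite /colours_at filter_rcons; case: ifP; rewrite ?map_rcons. Qed.

Lemma colours_at_nil h v :
  {in edges h, forall e, v \notin e} -> colours_at h v = [::].
Proof.
move=> hv; rewrite /colours_at (@eq_in_filter _ _ pred0) ?filter_pred0 //.
by move=> ec ech; apply/negbTE/hv/map_f.
Qed.

Lemma play_edges A h :
  play A h -> uniq (edges h) /\ {in edges h, forall e, #|e| = 2}.
Proof.
elim=> [|h' e _ [uniq_h' card_h'] card_e new_e]; first by [].
rewrite edges_rcons rcons_uniq new_e; split=> // e'.
by rewrite mem_rcons inE => /predU1P[->|/card_h'].
Qed.

Lemma degreeE h v : uniq (edges h) ->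
  degree (revealed h) v = size (colours_at h v).
Proof.
move=> uniq_h; rewrite /degree /incident size_map.
have -> : size [seq ec : {set V} * K <- h | v \in ec.1] =
    size [seq e : {set V} <- edges h | v \in e].
  by rewrite filter_map size_map.
rewrite -(card_uniqP _) ?filter_uniq //; apply: eq_card => e.
by rewrite inE mem_revealed mem_filter andbC.
Qed.

Lemma colour_of_mem h e c : uniq (edges h) -> (e, c) \in h ->
  colour_of h e = Some c.
Proof.
elim: h => [|[e' c'] h IHh] //= /andP[e'h uniq_h].
rewrite inE /colour_of /= => /predU1P[[<- <-]|ech]; first by rewrite eqxx.
have /negbTE-> : e' != e by apply: contraNneq e'h => ->; apply: (map_f fst ech).
exact: IHh.
Qed.

Lemma colour_classE h v c : uniq (edges h) ->
  #|[set e in incident (revealed h) v | colour_of h e == Some c]| =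
  count_mem c (colours_at h v).
Proof.
move=> uniq_h; rewrite count_map count_filter -size_filter.
set s := filter _ _; rewrite -(size_map fst s) -(card_uniqP _); last first.
  exact: subseq_uniq (map_subseq _ (filter_subseq _ _)) uniq_h.
apply: eq_card => e; rewrite !inE.
apply/idP/mapP => [/andP[/andP[/mapP[[e' c'] ech /= ->] ve]]|[[e' c']]].
  rewrite (colour_of_mem uniq_h ech) => /eqP[cc'].
  by exists (e', c') => //; rewrite mem_filter /= -cc' eqxx ve.
rewrite mem_filter /= => /andP[/andP[/eqP-> ve] ech] ->.
by rewrite (colour_of_mem uniq_h ech) ve eqxx (map_f fst ech).
Qed.

(** * Fixed lists of edges as Presenters *)

Definition fixed_presenter (es : seq {set V}) : presenter V K :=
  fun g => nth None (map Some es) (size g).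

Lemma fixed_presenter_occurs A es h :
  occurs A (fixed_presenter es) h -> edges h = take (size h) es.
Proof.
elim=> [|h' e _ IHh]; first by rewrite take0.
rewrite /fixed_presenter edges_rcons size_rcons IHh => nth_e.
have lt_h : size h' < size es.
  by rewrite ltnNge; apply/negP => le_h; rewrite nth_default ?size_map in nth_e.
rewrite (nth_map e) // in nth_e; case: nth_e => nth_e.
by rewrite (take_nth e lt_h) nth_e.
Qed.

(** The list must be allowed to continue after [h]: a prefix of a play is met by
    a Presenter who still has edges to show. *)
Lemma play_occurs A h (es : seq {set V}) :
  play A h -> occurs A (fixed_presenter (edges h ++ es)) h.
Proof.
move=> play_h; elim: play_h es => [|h' e _ IHh _ _] es; first exact: occurs_start.
rewrite edges_rcons cat_rcons; apply: occurs_round => //.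
by rewrite /fixed_presenter map_cat nth_cat !size_map ltnn subnn.
Qed.

(** Legality quantifies over all algorithms, but the edges shown do not depend on
    the answers: that the play against one algorithm ends in a graph of minimum
    degree [d] is enough. *)
Lemma fixed_presenter_legal A d h :
  play A h -> has_min_degree (revealed h) d ->
  legal_presenter d (fixed_presenter (edges h)).
Proof.
move=> /play_edges[uniq_h card_h] min_h B g occ_g.
have edges_g := fixed_presenter_occurs occ_g.
rewrite /fixed_presenter; case: (ltnP (size g) (size (edges h))) => [lt_g|le_g].
  rewrite (nth_map set0) //; split; first exact/card_h/mem_nth.
  rewrite mem_revealed edges_g; move: uniq_h.
  rewrite -{1}(cat_take_drop (size g) (edges h)) cat_uniq => /and3P[_ /hasPn disj _].
  by apply: disj; rewrite (drop_nth set0) // mem_head.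
rewrite nth_default ?size_map //; last by rewrite size_map in le_g.
suff -> : revealed g = revealed h by [].
by apply/setP => e; rewrite !mem_revealed edges_g take_oversize.
Qed.

Lemma winning_majority A d h v c :
  winning_algorithm d A -> play A h -> has_min_degree (revealed h) d ->
  2 * count_mem c (colours_at h v) <= size (colours_at h v).
Proof.
move=> win play_h min_h; have [uniq_h _] := play_edges play_h.
have occ_h : occurs A (fixed_presenter (edges h)) h.
  by rewrite -[edges h]cats0; apply: play_occurs.
rewrite -colour_classE // -degreeE //.
apply: (win _ (fixed_presenter_legal play_h min_h) h occ_h).
by rewrite /fixed_presenter nth_default // !size_map.
Qed.

(** * The majority condition before the end of the game *)

Lemma play_extend A h (es : seq {set V}) :
    play A h -> {in es, forall e, #|e| = 2} ->
  exists t, [/\ play A (h ++ t), {subset edges t <= es} &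
                {subset es <= edges (h ++ t)}].
Proof.
elim: es h => [|e es IHes] h play_h card_es.
  by exists [::]; rewrite cats0.
have card_es' : {in es, forall e', #|e'| = 2}.
  by move=> e' e'es; apply: card_es; rewrite inE e'es orbT.
have [e_h|e_h] := boolP (e \in edges h).
  have [t [play_t t_es es_t]] := IHes h play_h card_es'.
  exists t; split=> // e'; first by move=> /t_es e'es; rewrite inE e'es orbT.
  by rewrite inE => /predU1P[->|/es_t//]; rewrite edges_cat mem_cat e_h.
have play_e := play_round play_h (card_es e (mem_head _ _)) e_h.
have [t [play_t t_es es_t]] := IHes _ play_e card_es'.
exists ((e, A h e) :: t); rewrite -cat_rcons; split=> // e'.
  by rewrite !inE => /predU1P[->|/t_es ->]; rewrite ?eqxx ?orbT.
rewrite inE => /predU1P[->|/es_t//].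
by rewrite edges_cat edges_rcons mem_cat mem_rcons mem_head.
Qed.

Lemma set2_inj w : {in [set~ w] &, injective (fun x => [set w; x])}.
Proof.
move=> x y; rewrite !inE => xw yw /setP/(_ x).
by rewrite !inE eqxx orbT (negbTE xw) => /esym/eqP.
Qed.

(** The rest of the game can be played away from [v]: all pairs avoiding [v] and
    [w] are revealed, and [w] is joined to a set [Y] of [d] vertices, so that
    [w] has the minimum degree.  The edges at [v] and their colours are then the
    same in the final graph. *)
Lemma majority_before_end A d h v w c :
    d + 3 <= #|V| -> winning_algorithm d A -> play A h ->
    v != w -> colours_at h w = [::] -> d <= size (colours_at h v) ->
  2 * count_mem c (colours_at h v) <= size (colours_at h v).
Proof.
move=> cardV win play_h vw w0 dv.
have [|Y Ysub cardY] := @subset_of_card _ (~: [set v; w]) d.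
  by rewrite cardsCs setCK cards2 vw; lia.
have notY x : x \in Y -> x != v /\ x != w.
  by move=> /(subsetP Ysub); rewrite !inE negb_or => /andP[].
pose es := [seq e : {set V} <- enum {set V} | [&& #|e| == 2, v \notin e & w \notin e]]
           ++ [seq [set w; x] | x <- enum Y].
have card_es : {in es, forall e, #|e| = 2 /\ v \notin e}.
  move=> e; rewrite mem_cat mem_filter => /orP[/andP[/and3P[/eqP-> ->]]//|].
  case/mapP => x; rewrite mem_enum => /notY[xv xw] ->.
  by rewrite cards2 !inE (negbTE vw) eq_sym xw eq_sym xv.
have [t [play_t t_es es_t]] := play_extend play_h (fun e He => (card_es e He).1).
have [uniq_t _] := play_edges play_t.
have tv : colours_at (h ++ t) v = colours_at h v.
  by rewrite colours_at_cat [colours_at t v]colours_at_nil ?cats0 // => e /t_es/card_es[].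
suff min_t : has_min_degree (revealed (h ++ t)) d.
  by rewrite -tv; apply: winning_majority win play_t min_t.
have hw e : e \in edges h -> w \notin e.
  move=> /mapP[ec ech ->]; apply: contraT; rewrite negbK => wec.
  have : ec.2 \in colours_at h w by apply/map_f; rewrite mem_filter wec.
  by rewrite w0.
have degw : degree (revealed (h ++ t)) w = d.
  rewrite -cardY -(card_in_imset (f := fun x => [set w; x])); last first.
    apply: sub_in2 (@set2_inj w) => x /notY[_]; by rewrite !inE.
  apply: eq_card => e; rewrite inE mem_revealed.
  apply/andP/imsetP => [[]|[x xY ->]].
    rewrite edges_cat mem_cat => /orP[/hw/negbTE->//|/t_es].
    rewrite mem_cat mem_filter => /orP[/andP[/and3P[_ _ /negbTE->]]//|].
    by case/mapP => x; rewrite mem_enum => xY -> _; exists x.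
  rewrite !inE eqxx; split=> //; apply: es_t.
  by rewrite mem_cat (map_f (fun x => [set w; x])) ?orbT // mem_enum.
split; last by exists w.
move=> x; have [->|xv] := eqVneq x v; first by rewrite degreeE // tv.
have [->|xw] := eqVneq x w; first by rewrite degw.
apply: (@leq_trans #|~: [set v; w; x]|).
  have card_vwx : #|[set v; w; x]| <= 3.
    by rewrite cardsU cards1 cards2; case: (_ != _); lia.
  by rewrite cardsCs setCK; lia.
rewrite -(card_in_imset (f := fun y => [set x; y])); last first.
  apply: sub_in2 (@set2_inj x) => y; by rewrite !inE !negb_or => /andP[].
apply/subset_leq_card/subsetP => e /imsetP[y].
rewrite !inE !negb_or -andbA => /and3P[yv yw yx] ->.
rewrite !inE eqxx andbT; apply: es_t; rewrite mem_cat mem_filter mem_enum.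
by rewrite cards2 !inE !negb_or (eq_sym x) yx (eq_sym v) xv (eq_sym v) yv
           (eq_sym w) xw (eq_sym w) yw.
Qed.

(** * Forcing a vertex whose colours all lie in one class *)

(** In the induction step, for [i + 1] and [j + 1], two vertices built from
    disjoint sets [F1] and [F2] of isolated vertices are joined: one with [j]
    edges coloured outside [S] and one with [i] edges coloured in [S].  Keeping
    all new edges inside the given set makes the second construction harmless to
    the first vertex.  The binomial coefficient counts isolated vertices:
    Pascal's rule says that [F] can be split into [F1] and [F2], and one vertex
    suffices if [i = 0] or [j = 0]. *)
Lemma force_pure A (S : pred K) i j h F :
    play A h -> {in edges h, forall e, [disjoint e & F]} ->
    'C(i + j, i) <= #|F| ->
  exists t v, [/\ play A (h ++ t),
    {in edges t, forall e : {set V}, e \subset F}, v \in F &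
    (size (colours_at (h ++ t) v) = i /\ all S (colours_at (h ++ t) v)) \/
    (size (colours_at (h ++ t) v) = j /\ all (predC S) (colours_at (h ++ t) v))].
Proof.
have base h' F' : {in edges h', forall e, [disjoint e & F']} ->
    0 < #|F'| -> exists2 v, v \in F' & colours_at h' v = [::].
  move=> disj /card_gt0P[v vF]; exists v => //; apply: colours_at_nil => e eh.
  by rewrite (disjointFl (disj e eh) vF).
elim: i j h F => [|i IHi] j h F play_h disj.
  rewrite bin0 => /(base h F disj)[v vF v0].
  by exists [::], v; rewrite cats0 v0; split=> //; left.
elim: j h F play_h disj => [|j IHj] h F play_h disj.
  rewrite addn0 binn => /(base h F disj)[v vF v0].
  by exists [::], v; rewrite cats0 v0; split=> //; right.
rewrite addSn binS addnS -addSn => cardF.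
have [F1 F1F cardF1] := subset_of_card (leq_trans (leq_addr _ _) cardF).
pose F2 := F :\: F1.
have F2F : F2 \subset F by exact: subsetDl.
have F12 : [disjoint F1 & F2].
  by rewrite disjoint_sym disjoints_subset subDset setUCr subsetT.
have cardF2 : 'C(i + j.+1, i) <= #|F2|.
  by move: cardF; rewrite cardsD (setIidPr F1F) cardF1 addnS -addSn; lia.
have disj1 : {in edges h, forall e, [disjoint e & F1]}.
  by move=> e /disj; apply: disjointWr.
have [t1 [v1 [play1 t1F v1F pure1]]] := IHj _ _ play_h disj1 (eq_leq (esym cardF1)).
have disj2 : {in edges (h ++ t1), forall e, [disjoint e & F2]}.
  move=> e; rewrite edges_cat mem_cat => /orP[/disj|/t1F eF1].
    exact: disjointWr.
  exact: disjointWl F12.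
have [t2 [v2 [play2 t2F v2F pure2]]] := IHi _ _ _ play1 disj2 cardF2.
have v12 : v1 != v2.
  by apply: contraTneq v2F => <-; rewrite (disjointFr F12 v1F).
have v1t2 : colours_at (h ++ t1 ++ t2) v1 = colours_at (h ++ t1) v1.
  rewrite catA colours_at_cat [colours_at t2 v1]colours_at_nil ?cats0 // => e /t2F eF2.
  by apply/negP => /(subsetP eF2); rewrite (disjointFr F12 v1F).
have sub1 : {in edges t1, forall e : {set V}, e \subset F}.
  by move=> e /t1F eF; apply: subset_trans F1F.
have sub2 : {in edges t2, forall e : {set V}, e \subset F}.
  by move=> e /t2F eF; apply: subset_trans F2F.
have sub12 : {in edges (t1 ++ t2), forall e : {set V}, e \subset F}.
  by move=> e; rewrite edges_cat mem_cat => /orP[/sub1|/sub2].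
rewrite -catA in play2 pure2.
case: pure1 => [pure1|[size1 all1]].
  by exists (t1 ++ t2), v1; split; rewrite ?(subsetP F1F) // v1t2; left.
case: pure2 => [[size2 all2]|pure2]; last first.
  by exists (t1 ++ t2), v2; split; rewrite ?(subsetP F2F) //; right.
pose e := [set v1; v2].
have card_e : #|e| = 2 by rewrite cards2 v12.
have new_e : e \notin edges (h ++ t1 ++ t2).
  rewrite catA edges_cat mem_cat negb_or; apply/andP; split; apply/negP.
    move=> /disj2 /disjointFl/(_ v2F); by rewrite !inE eqxx orbT.
  by move=> /t2F /subsetP/(_ v1); rewrite (disjointFr F12 v1F) !inE eqxx => /(_ isT).
have := play_round play2 card_e new_e.
set c := A _ _; rewrite rcons_cat => play3.
have sub3 : {in edges (rcons (t1 ++ t2) (e, c)), forall e : {set V}, e \subset F}.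
  move=> e'; rewrite edges_rcons mem_rcons inE => /predU1P[->|/sub12//].
  by rewrite subUset !sub1set (subsetP F1F) // (subsetP F2F).
have [cS|cS] := boolP (S c).
  exists (rcons (t1 ++ t2) (e, c)), v2; split; rewrite ?(subsetP F2F) //; left.
  by rewrite -rcons_cat colours_at_rcons !inE eqxx orbT size_rcons all_rcons size2 cS.
exists (rcons (t1 ++ t2) (e, c)), v1; split; rewrite ?(subsetP F1F) //; right.
by rewrite -rcons_cat colours_at_rcons !inE eqxx v1t2 size_rcons all_rcons size1 /= cS.
Qed.

(** Two colours that are each used at most [size s / 2] times cannot fill up an
    odd number of places. *)
Lemma odd_pure_not_majority (s : seq K) c1 c2 :
  odd (size s) -> {in s, forall c, (c == c1) || (c == c2)} ->
  exists c, size s < 2 * count_mem c s.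
Proof.
move=> odd_s s_sub.
have : size s <= count_mem c1 s + count_mem c2 s.
  rewrite -count_predUI -size_filter (_ : filter _ s = s) ?leq_addr //.
  exact/all_filterP/allP.
case: (leqP (size s) (2 * count_mem c1 s)) => [le1|lt1] le_s.
  exists c1; rewrite ltn_neqAle le1 andbT; apply: contraL odd_s => /eqP->.
  by rewrite mul2n odd_double.
by exists c2; lia.
Qed.

End Plays.

(** * The number of vertices *)

Lemma central_bin_le D : 'C(D + D, D) <= 4 ^ D.
Proof.
rewrite -[4]/(2 ^ 2) -expnM mul2n -addnn -[2]/(1 + 1) expnDn.
rewrite (bigD1 (inord D)) //= inordK; last by rewrite ltnS leq_addr.
by rewrite !exp1n !muln1 leq_addr.
Qed.

Lemma no_winning_algorithm n d (A : algorithm 'I_n 'I_4) :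
  4 ^ d.+2 <= n -> ~ winning_algorithm d A.
Proof.
move=> le_n win.
have [D odd_D /andP[dD Dd]] : exists2 D, odd D & d <= D <= d.+1.
  by exists (d + ~~ odd d); rewrite ?oddD; case: (odd d); rewrite //=; lia.
have le_nD : 4 ^ D.+1 <= n by apply: leq_trans le_n; rewrite leq_exp2l.
have lt_d := ltn_expl d.+2 (isT : 1 < 4).
have n_gt0 : 0 < n by lia.
(* [w] is kept isolated, so that the game can still be ended. *)
pose w := Ordinal n_gt0.
have cardF : 'C(D + D, D) <= #|[set~ w]|.
  apply: leq_trans (central_bin_le D) _; rewrite cardsC1 card_ord.
  by move: le_nD; rewrite expnS; have := expn_gt0 4 D; lia.
have [|t [v [play_t t_sub vF pure]]] :=
  @force_pure _ _ A (fun c : 'I_4 => c < 2) D D [::] [set~ w] (play_start A) _ cardF.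
  by [].
rewrite cat0s in play_t pure.
have vw : v != w by rewrite !inE in vF.
have w0 : colours_at t w = [::].
  apply: colours_at_nil => e /t_sub/subsetP sub_e; apply/negP => /sub_e.
  by rewrite !inE eqxx.
have [c] : exists c, size (colours_at t v) < 2 * count_mem c (colours_at t v).
  case: pure => [[size_v all_v]|[size_v all_v]].
    apply: (@odd_pure_not_majority _ _ (inord 0) (inord 1)); first by rewrite size_v.
    move=> c /(allP all_v) /=; rewrite -!val_eqE /= !inordK //; lia.
  apply: (@odd_pure_not_majority _ _ (inord 2) (inord 3)); first by rewrite size_v.
  move=> c /(allP all_v) /=; rewrite -!val_eqE /= !inordK //.
  by have := ltn_ord c; lia.
have size_v : size (colours_at t v) = D by case: pure => [[]|[]].
rewrite ltnNge (majority_before_end _ _ win play_t vw w0) // ?size_v //.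
by rewrite card_ord; lia.
Qed.

Local Open Scope classical_set_scope.
Local Open Scope ring_scope.

Theorem corollary6 (R : realType) (delta : nat -> nat)
    (delta_ge2 : forall n : nat, (2 <= delta n)%N)
    (delta_small : (fun n : nat => (delta n)%:R : R) =O_\oo
       (fun n : nat => ln (n%:R : R) / ln (ln (n%:R : R)))) :
  \forall n \near \oo,
    ~ exists A : algorithm 'I_n 'I_4, winning_algorithm (delta n) A.
Proof.
have /eqO_exP[k k_gt0 bound] := delta_small.
have ln_oo (a : R) : \forall n \near \oo, a <= ln (n%:R : R).
  near=> n.
  have : expR a <= n%:R by near: n; exact: nbhs_infty_ger.
  by move=> le_n; rewrite -[a]expRK ler_ln ?posrE ?expR_gt0 // (lt_le_trans (expR_gt0 a)).
near=> n => -[A]; apply: no_winning_algorithm.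
(* [8 * k <= ln (ln n)] gives [8 * delta n <= ln n]; with [16 <= ln n] this yields
   [4 * (delta n + 2) <= ln n], and [ln 4 <= 4]. *)
have ln_ge : Num.max 16%:R (expR (8 * k)) <= ln (n%:R : R) by near: n.
move: ln_ge; rewrite ge_max => /andP[ln_ge16 ln_ge].
have lnln_ge : 8 * k <= ln (ln (n%:R : R)).
  by rewrite -[8 * k]expRK ler_ln ?posrE ?expR_gt0 // (lt_le_trans (expR_gt0 (8 * k))).
have : `|(delta n)%:R : R| <= k * `|ln (n%:R : R) / ln (ln (n%:R : R))|.
  by near: n.
set L := ln n%:R in ln_ge16 ln_ge lnln_ge *.
have L_gt0 : 0 < L by lra.
have LL_gt0 : 0 < ln L by lra.
have ratio_ge0 : 0 <= L / ln L by rewrite divr_ge0 ?ltW.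
rewrite normr_nat (ger0_norm ratio_ge0) mulrA ler_pdivlMr // => le_d.
have {}le_d : 8 * (delta n)%:R <= L.
  rewrite -(ler_pM2l k_gt0) (le_trans _ le_d) // mulrCA mulrA mulrC.
  by rewrite ler_wpM2l.
have n_gt0 : 0 < n%:R :> R.
  rewrite ltr0n lt0n; apply/eqP => n0.
  by move: L_gt0; rewrite /L n0 ln0 ?ltxx.
rewrite -(ler_nat R) -ler_ln ?posrE // ?ltr0n ?expn_gt0 // natrX.
rewrite lnXn ?ltr0n // -/L.
have : ln (4 : R) <= 4 by rewrite ltW // ln_sublinear.
move=> ln4; rewrite (@le_trans _ _ (4 *+ (delta n).+2)) ?lerMn2r ?ln4 ?orbT //.
by rewrite -mulr_natr -addn2 natrD; lra.
Unshelve. all: by end_near.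
Qed.
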